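(* There exists a disjunctive sum of (at least two) single-heap Robin Hood positions, with components of pairwise distinct temperatures, and a player such that this player, moving first in the sum, has a unique winning move, and this move is in the coolest component (the component of lowest temperature).
   Context: Games are short partizan combinatorial games (players Left and Right) under normal play (a player who cannot move loses); equality, order, disjunctive sums and canonical forms of games are the usual ones. In a disjunctive sum the player to move chooses one component and moves in it. Robin Hood: for non-negative integers $n,a,b$ (heap size, Left's wealth, Right's wealth), the position $(n;a,b)$ has Left options $(n-i;\,a,\,\max\{b-i,0\})$ for $1\le i\le\min\{n,a\}$ and Right options $(n-j;\,\max\{a-j,0\},\,b)$ for $1\le j\le \min\{n,b\}$. Stops: if $G$ equals a dyadic rational number game $x$, then $\mathrm{Ls}(G)=\mathrm{Rs}(G)=x$; otherwise $\mathrm{Ls}(G)=\max_{G^L}\mathrm{Rs}(G^L)$ and $\mathrm{Rs}(G)=\min_{G^R}\mathrm{Ls}(G^R)$, over Left options $G^L$ and Right options $G^R$. Penalized position: for $G$ in canonical form and a non-negative dyadic $p$, $G_p$ is defined recursively by $G_p=\{(G^{L})_p-p \mid (G^{R})_p+p\}$ ($G^L$, $G^R$ ranging over all Left and Right options) for $0\le p\le \tau$, where $\tau$ is the minimum $p$ for which the Left and Right stops of $G_p$ are equal to a dyadic, say $x$; and $G_p=x$ for all $p>\tau$. Temperature: if $G$ equals a dyadic $k/2^n$ ($n\ge 0$, with $k$ odd if $n>0$), then its temperature is $-1/2^n$; otherwise it is the smallest non-negative dyadic $p$ with $\mathrm{Ls}(G_p)=\mathrm{Rs}(G_p)$. *)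

(* Defs.v *)
From mathcomp Require Import all_boot all_order all_algebra.
From mathcomp Require Import boolp classical_sets.

Set Implicit Arguments.
Unset Strict Implicit.
Unset Printing Implicit Defensive.

Import Order.TTheory GRing.Theory Num.Theory.
Local Open Scope ring_scope.

Inductive player := Left | Right.

Definition opponent (s : player) : player :=
  if s is Left then Right else Left.

Inductive game := Game of seq game & seq game.

Definition options (s : player) (G : game) : seq game :=
  let: Game GL GR := G in if s is Left then GL else GR.

Definition game0 : game := Game [::] [::].

(* Normal play: [wins_first s G] says that [s], moving first in [G], wins. *)
Fixpoint wins_first (s : player) (G : game) : bool :=
  let: Game GL GR := G in
  if s is Left then has (fun H => ~~ wins_first Right H) GL
  else has (fun H => ~~ wins_first Left H) GR.

Definition wins_second (s : player) (G : game) : bool :=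
  ~~ wins_first (opponent s) G.

Fixpoint game_opp (G : game) : game :=
  let: Game GL GR := G in Game (map game_opp GR) (map game_opp GL).

Fixpoint game_add (G : game) : game -> game :=
  fix add_G (H : game) : game :=
    let: Game GL GR := G in
    let: Game HL HR := H in
    Game ([seq game_add X H | X <- GL] ++ [seq add_G Y | Y <- HL])
         ([seq game_add X H | X <- GR] ++ [seq add_G Y | Y <- HR]).

Definition game_sub (G H : game) : game := game_add G (game_opp H).

Definition game_sum (s : seq game) : game := foldr game_add game0 s.

(* Conway's order: G <= H iff no Left option X of G has H <= X and no Right
   option Y of H has Y <= G.  The recursion exchanges the two arguments, so it
   computes the pair (G <= H, H <= G). *)
Fixpoint game_cmp (G : game) : game -> bool * bool :=
  fix cmp_G (H : game) : bool * bool :=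
    let: Game GL GR := G in
    let: Game HL HR := H in
    (all (fun X => ~~ (game_cmp X H).2) GL && all (fun Y => ~~ (cmp_G Y).2) HR,
     all (fun Y => ~~ (cmp_G Y).1) HL && all (fun X => ~~ (game_cmp X H).1) GR).

Definition game_le (G H : game) : bool := (game_cmp G H).1.
Definition game_eq (G H : game) : bool := game_le G H && game_le H G.

Definition incomparable (G H : game) : bool :=
  ~~ game_le G H && ~~ game_le H G.

(* No dominated option (two options of one player are never comparable, which
   also forbids listing an option twice), no reversible option, hereditarily. *)
Fixpoint canonical (G : game) : bool :=
  let: Game GL GR := G in
  [&& pairwise incomparable GL, pairwise incomparable GR,
      all (fun X => all (fun XR => ~~ game_le XR G) (options Right X)) GL,
      all (fun Y => all (fun YL => ~~ game_le G YL) (options Left Y)) GR,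
      all canonical GL & all canonical GR].

Definition dyadic (x : rat) : Prop :=
  exists (k : int) (n : nat), x = k%:~R / 2 ^+ n.

Definition int_game (k : int) : game :=
  match k with
  | Posz n => iter n (fun G => Game [:: G] [::]) game0
  | Negz n => iter n.+1 (fun G => Game [::] [:: G]) game0
  end.

(* The canonical form of k / 2^n: if k = 2 m + 1 and n > 0 it is
   {m / 2^(n-1) | (m + 1) / 2^(n-1)}. *)
Fixpoint dyadic_game (k : int) (n : nat) : game :=
  if n is n'.+1 then
    let m := (k %/ 2)%Z in
    if (2 %| k)%Z then dyadic_game m n'
    else Game [:: dyadic_game m n'] [:: dyadic_game (m + 1) n']
  else int_game k.

(* Meaningful only for dyadic x, whose denominator is a power of 2. *)
Definition num_game (x : rat) : game :=
  dyadic_game (numq x) (logn 2 `|denq x|%N).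

Definition equals_num (G : game) (x : rat) : Prop :=
  dyadic x /\ game_eq G (num_game x).

Definition is_num (G : game) : Prop := exists x, equals_num G x.

Definition num_value (G : game) : rat := xget 0 [set x | equals_num G x].

(* Used on nonempty sequences only: a game equal to no number has both Left and
   Right options. *)
Definition seq_max (s : seq rat) : rat := foldr Num.max (head 0 s) s.
Definition seq_min (s : seq rat) : rat := foldr Num.min (head 0 s) s.

Fixpoint stop (s : player) (G : game) : rat :=
  let: Game GL GR := G in
  if `[< is_num G >] then num_value G
  else if s is Left then seq_max [seq stop Right X | X <- GL]
  else seq_min [seq stop Left Y | Y <- GR].

Definition least_dyadic (P : rat -> Prop) (p : rat) : Prop :=
  [/\ dyadic p, 0 <= p, P p &
      forall q, dyadic q -> 0 <= q -> P q -> p <= q].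

(* [raw q] is {(G^L)_q - q | (G^R)_q + q}, which is G_q as long as q <= tau.
   The minimum tau exists, so the default value 0 is not used. *)
Fixpoint penalized (G : game) (p : rat) : game :=
  let: Game GL GR := G in
  let raw q :=
    Game [seq game_sub (penalized X q) (num_game q) | X <- GL]
         [seq game_add (penalized Y q) (num_game q) | Y <- GR] in
  let tau :=
    xget 0 [set q | least_dyadic
                      (fun r => stop Left (raw r) = stop Right (raw r)) q] in
  if p <= tau then raw p else num_game (stop Left (raw tau)).

Definition num_temperature (G : game) (t : rat) : Prop :=
  exists (k : int) (n : nat),
    [/\ (0 < n)%N -> odd `|k|%N, game_eq G (dyadic_game k n)
      & t = - (1 / 2 ^+ n)].

Definition nonnum_temperature (G : game) (t : rat) : Prop :=
  exists K : game,
    [/\ canonical K, game_eq K G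
      & least_dyadic
          (fun p => stop Left (penalized K p) = stop Right (penalized K p)) t].

Definition temperature (G : game) (t : rat) : Prop :=
  num_temperature G t \/ (~ is_num G /\ nonnum_temperature G t).

Record robin_hood := RobinHood { heap : nat; lwealth : nat; rwealth : nat }.

Definition wealth (s : player) (P : robin_hood) : nat :=
  if s is Left then lwealth P else rwealth P.

Definition legal (s : player) (P : robin_hood) (i : nat) : bool :=
  (1 <= i <= minn (heap P) (wealth s P))%N.

(* Subtraction on nat is truncated at 0. *)
Definition move (s : player) (P : robin_hood) (i : nat) : robin_hood :=
  let: RobinHood n a b := P in
  if s is Left then RobinHood (n - i) a (b - i)
  else RobinHood (n - i) (a - i) b.

(* Every move shrinks the heap, so the heap size is enough fuel. *)
Fixpoint rh_game_fuel (m : nat) (P : robin_hood) : game :=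
  if m is m'.+1 then
    let opts s := [seq rh_game_fuel m' (move s P i)
                  | i <- iota 1 (minn (heap P) (wealth s P))] in
    Game (opts Left) (opts Right)
  else game0.

Definition rh_game (P : robin_hood) : game := rh_game_fuel (heap P) P.

(* In a sum, the move (c, i) removes i from the heap of component c. *)

Definition rh_default : robin_hood := RobinHood 0 0 0.

Definition component (S : seq robin_hood) (c : nat) : robin_hood :=
  nth rh_default S c.

Definition sum_legal (s : player) (S : seq robin_hood) (m : nat * nat) : bool :=
  (m.1 < size S)%N && legal s (component S m.1) m.2.

Definition sum_move (s : player) (S : seq robin_hood) (m : nat * nat) :
    seq robin_hood :=
  set_nth rh_default S m.1 (move s (component S m.1) m.2).

Definition winning_move (s : player) (S : seq robin_hood) (m : nat * nat) :
    bool :=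
  sum_legal s S m && wins_second s (game_sum (map rh_game (sum_move s S m))).

(* Main.v *)
Require Import Defs.
From HB Require Import structures.
From mathcomp Require Import all_boot all_order all_algebra.
From mathcomp Require Import boolp classical_sets.
From mathcomp Require Import zify ring lra.

Set Implicit Arguments.
Unset Strict Implicit.
Unset Printing Implicit Defensive.

Import Order.TTheory GRing.Theory Num.Theory.
Local Open Scope ring_scope.

(** The witness is the sum of (4; 1, 2), which is {{2 | -2} | -3}, and of
(3; 1, 1), which is the switch {2 | -2}.  The second has temperature 2: cooling
by p turns it into {2 - p | -2 + p}, whose stops meet at p = 2.  The first has
temperature 1: for p <= 1 its Left stop stays at -2, because Left's move creates
a switch on which Right answers at once and the two taxes cancel, while its
Right stop is -3 + p.

Left, moving first, must nevertheless move in the cooler component.  That move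
leaves {2 | -2} + {2 | -2}, which is zero as a switch around zero is its own
negative, so Left wins by mirroring.  The hotter move leaves {{2 | -2} | -3} + 2,
and Right answers to -3 + 2 < 0.  As Left's wealth is 1 in both heaps, these are
the only two moves; these outcomes are finite computations.

What needs proof is the temperatures, since the stops of the cooled games must
be known at every dyadic penalty p.  Three facts carry this.  Conway's order is a
preorder compatible with addition ([game_le_trans], [game_le_add]).  Canonical
dyadic games are ordered, and add up, as the rationals that they name
([game_le_dyadic_sum]), so a game equals at most one number and the stops of
number-valued options can be read off.  Finally, adding a number w to a switch
{a | b} moves its Right stop from b to b + w ([stop_right_switch_num]), although
the sum has many further options, in w. *)

(** * The order and the sum of games *)

(** Classical equality on games gives access to membership in option lists. *)
HB.instance Definition _ := gen_eqMixin game.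

Fixpoint game_size (G : game) : nat :=
  let: Game GL GR := G in
  (sumn (map game_size GL) + sumn (map game_size GR)).+1.

Lemma game_size_option (s : player) (G X : game) :
  X \in options s G -> (game_size X < game_size G)%N.
Proof.
have le_sumn (Y : game) (r : seq game) :
    Y \in r -> (game_size Y <= sumn (map game_size r))%N.
  elim: r => //= Z r IHr; rewrite inE => /orP [/eqP -> | /IHr]; lia.
by case: s G => [] [GL GR] /= /le_sumn; lia.
Qed.

(** The induction principle generated for [game] gives no hypothesis on the
members of the option lists; this one does. *)
Lemma game_ind_options (P : game -> Prop) :
    (forall G, (forall s X, X \in options s G -> P X) -> P G) ->
  forall G, P G.
Proof.
move=> step G; have [n] := ubnP (game_size G).
elim: n G => // n IHn G ltGn; apply: step => s X /game_size_option ltXG.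
by apply: IHn; lia.
Qed.

Lemma options_add (s : player) (G H : game) :
  options s (game_add G H) =
    [seq game_add X H | X <- options s G]
    ++ [seq game_add G Y | Y <- options s H].
Proof. by case: s G H => [] [GL GR] [HL HR]. Qed.

Lemma options_opp (s : player) (G : game) :
  options s (game_opp G) = map game_opp (options (opponent s) G).
Proof. by case: s G => [] []. Qed.

Lemma game_eta (G : game) : G = Game (options Left G) (options Right G).
Proof. by case: G. Qed.

Lemma game_size_opp (G : game) : game_size (game_opp G) = game_size G.
Proof.
elim/game_ind_options: G => -[GL GR] IH /=; rewrite addnC -!map_comp.
by congr (_ + _).+1; congr sumn; apply/eq_in_map => X inX;
  [apply: (IH Left) | apply: (IH Right)].
Qed.

Lemma game_add0 (G : game) : game_add G game0 = G.
Proof.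
elim/game_ind_options: G => -[GL GR] IH /=; rewrite !cats0.
by congr Game; apply: map_id_in => X inX; [apply: (IH Left) | apply: (IH Right)].
Qed.

Lemma game_opp_add (G H : game) :
  game_opp (game_add G H) = game_add (game_opp G) (game_opp H).
Proof.
elim/game_ind_options: G H => G IHG; elim/game_ind_options=> H IHH.
rewrite (game_eta (game_opp _)) [RHS]game_eta !options_opp !options_add.
rewrite !options_opp !map_cat -!map_comp.
by congr Game; congr cat; apply/eq_in_map => X inX /=;
  (exact: (IHG _ _ inX) || exact: (IHH _ _ inX)).
Qed.

(** The two components of [game_cmp] are the same relation with its arguments
exchanged, which is what makes the recursive equation [game_leP] hold. *)
Lemma game_cmp_swap (G H : game) :
  game_cmp G H = ((game_cmp H G).2, (game_cmp H G).1).
Proof.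
elim/game_ind_options: G H => -[GL GR] IHG.
elim/game_ind_options => -[HL HR] IHH /=.
have eq_all1 s r : {subset r <= options s (Game GL GR)} ->
    forall H, all (fun X => ~~ (game_cmp X H).1) r
                = all (fun X => ~~ (game_cmp H X).2) r.
  by move=> sub_r H; apply: eq_in_all => X /sub_r inX; rewrite (IHG s).
have eq_all2 s r : {subset r <= options s (Game GL GR)} ->
    forall H, all (fun X => ~~ (game_cmp X H).2) r
                = all (fun X => ~~ (game_cmp H X).1) r.
  by move=> sub_r H; apply: eq_in_all => X /sub_r inX; rewrite (IHG s).
congr (_ && _, _ && _).
- exact: (eq_all2 Left).
- by apply: eq_in_all => X inX; move: (IHH Right X inX) => /= ->.
- by apply: eq_in_all => X inX; move: (IHH Left X inX) => /= ->.
- exact: (eq_all1 Right).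
Qed.

Lemma game_leP (G H : game) :
  reflect ((forall X, X \in options Left G -> ~~ game_le H X)
             /\ (forall Y, Y \in options Right H -> ~~ game_le Y G))
          (game_le G H).
Proof.
have -> : game_le G H = all (fun X => ~~ game_le H X) (options Left G)
                        && all (fun Y => ~~ game_le Y G) (options Right H).
  rewrite /game_le; case: G H => [GL GR] [HL HR] /=.
  congr (_ && _); apply: eq_all => X.
    by rewrite [in LHS]game_cmp_swap.
  by rewrite [in RHS]game_cmp_swap.
by apply: (iffP andP) => -[/allP ? /allP ?]; split=> //; apply/allP.
Qed.

Lemma game_le_refl (G : game) : game_le G G.
Proof.
elim/game_ind_options: G => G IH; apply/game_leP.
by split=> X inX; apply/negP => /game_leP [leL leR];
  [have := leL X inX | have := leR X inX]; rewrite (IH _ _ inX).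
Qed.

Lemma option_left_nge (G X : game) :
  X \in options Left G -> ~~ game_le G X.
Proof. by case/game_leP: (game_le_refl G) => + _; apply. Qed.

Lemma option_right_nle (G Y : game) :
  Y \in options Right G -> ~~ game_le Y G.
Proof. by case/game_leP: (game_le_refl G) => _; apply. Qed.

(** A violation of G <= K is an option X of G with K <= X, or one of K; with the
other hypothesis it gives a smaller instance of transitivity, with the three
games cyclically permuted.  Hence the induction on the total size. *)
Lemma game_le_trans (H G K : game) :
  game_le G H -> game_le H K -> game_le G K.
Proof.
have [n] := ubnP (game_size G + game_size H + game_size K).
elim: n G H K => // n IHn G H K lt_n leGH leHK.
apply/game_leP; split=> X inX; have ltX := game_size_option inX;
  apply/negP => leX.
  case/game_leP: (leGH) => /(_ X inX) /negP [].
  by apply: (IHn _ K) => //; lia.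
case/game_leP: (leHK) => _ /(_ X inX) /negP [].
by apply: (IHn _ G) => //; lia.
Qed.

(** Monotonicity of the sum and cancellation are proved together, because a
violation of one is an instance of the other at smaller games. *)
Lemma game_le_add_cancel (n : nat) (G H K M : game) :
    (game_size G + game_size H + game_size K + game_size M < n)%N ->
  [/\ game_le G K -> game_le H M -> game_le (game_add G H) (game_add K M),
      game_le (game_add G H) (game_add K M) -> game_le M H -> game_le G K
    & game_le (game_add G H) (game_add K M) -> game_le K G -> game_le H M].
Proof.
elim: n G H K M => // n IHn G H K M lt_n; split.
- move=> leGK leHM; apply/game_leP; split=> Z; rewrite options_add mem_cat;
    case/orP=> /mapP [X inX ->]; have ltX := game_size_option inX;
    apply/negP => leX.
  + case/game_leP: (leGK) => /(_ X inX) /negP [].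
    by case: (IHn K M X H) => [|_ + _]; [lia | apply].
  + case/game_leP: (leHM) => /(_ X inX) /negP [].
    by case: (IHn K M G X) => [|_ _]; [lia | apply].
  + case/game_leP: (leGK) => _ /(_ X inX) /negP [].
    by case: (IHn X M G H) => [|_ + _]; [lia | apply].
  + case/game_leP: (leHM) => _ /(_ X inX) /negP [].
    by case: (IHn K X G H) => [|_ _]; [lia | apply].
- move=> /game_leP [leL leR] leMH; apply/game_leP.
  split=> X inX; have ltX := game_size_option inX; apply/negP => leX.
  + have /leL/negP [] : game_add X H \in options Left (game_add G H).
      by rewrite options_add mem_cat (map_f (game_add^~ H)).
    by case: (IHn K M X H) => [|+ _ _]; [lia | apply].
  + have /leR/negP [] : game_add X M \in options Right (game_add K M).
      by rewrite options_add mem_cat (map_f (game_add^~ M)).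
    by case: (IHn X M G H) => [|+ _ _]; [lia | apply].
- move=> /game_leP [leL leR] leKG; apply/game_leP.
  split=> X inX; have ltX := game_size_option inX; apply/negP => leX.
  + have /leL/negP [] : game_add G X \in options Left (game_add G H).
      by rewrite options_add mem_cat (map_f (game_add G)) ?orbT.
    by case: (IHn K M G X) => [|+ _ _]; [lia | apply].
  + have /leR/negP [] : game_add K X \in options Right (game_add K M).
      by rewrite options_add mem_cat (map_f (game_add K)) ?orbT.
    by case: (IHn K X G H) => [|+ _ _]; [lia | apply].
Qed.

Lemma game_le_add (G H K M : game) :
  game_le G K -> game_le H M -> game_le (game_add G H) (game_add K M).
Proof. by case: (@game_le_add_cancel _ G H K M (ltnSn _)). Qed.

Lemma game_le_opp (G H : game) :
  game_le (game_opp G) (game_opp H) = game_le H G.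
Proof.
have [n] := ubnP (game_size G + game_size H).
elim: n G H => // n IHn G H lt_n.
have IH (s : player) X : X \in options s G ->
    game_le (game_opp H) (game_opp X) = game_le X H.
  by move/game_size_option => ltX; apply: IHn; lia.
have IH' (s : player) Y : Y \in options s H ->
    game_le (game_opp Y) (game_opp G) = game_le G Y.
  by move/game_size_option => ltX; apply: IHn; lia.
apply/game_leP/game_leP => -[leL leR]; split=> X.
- by move=> inX; rewrite -(IH' Left) // leR // options_opp map_f.
- by move=> inX; rewrite -(IH Right) // leL // options_opp map_f.
- by rewrite options_opp => /mapP [Y inY ->]; rewrite (IH Right) // leR.
- by rewrite options_opp => /mapP [Y inY ->]; rewrite (IH' Left) // leL.
Qed.

Lemma game_eq_refl (G : game) : game_eq G G.
Proof. by rewrite /game_eq game_le_refl. Qed.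

Lemma game_eq_trans (H G K : game) :
  game_eq G H -> game_eq H K -> game_eq G K.
Proof.
move=> /andP [leGH leHG] /andP [leHK leKH].
by rewrite /game_eq (game_le_trans leGH leHK) (game_le_trans leKH leHG).
Qed.

(** * Dyadic games are ordered as the rationals *)

Definition dyadic_val (k : int) (n : nat) : rat := k%:~R / 2 ^+ n.

Lemma dyadicN (x : rat) : dyadic x -> dyadic (- x).
Proof. by move=> [k [n ->]]; exists (- k), n; rewrite rmorphN /= mulNr. Qed.

Lemma dyadicD (x y : rat) : dyadic x -> dyadic y -> dyadic (x + y).
Proof.
move=> [k [n ->]] [l [m ->]]; exists (k * 2 ^+ m + l * 2 ^+ n), (n + m)%N.
rewrite rmorphD !rmorphM !rmorphXn /= exprD.
have nz j : (2 : rat) ^+ j != 0 by rewrite expf_neq0.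
by field; rewrite !nz.
Qed.

Lemma dyadic_int (k : int) : dyadic k%:~R.
Proof. by exists k, 0%N; rewrite expr0 divr1. Qed.

Lemma dyadic0 : dyadic 0.
Proof. exact: (dyadic_int 0). Qed.

Lemma dyadic_half (x : rat) : dyadic x -> dyadic (x / 2).
Proof.
move=> [k [n ->]]; exists k, n.+1.
by rewrite exprS invfM mulrA mulrAC.
Qed.

Lemma dyadic_val_even (k : int) (n : nat) :
  dyadic_val (2 * k) n.+1 = dyadic_val k n.
Proof.
rewrite /dyadic_val rmorphM exprS /=.
have nz j : (2 : rat) ^+ j != 0 by rewrite expf_neq0.
by field; rewrite nz.
Qed.

Lemma dyadic_val_succ (k : int) (n : nat) :
  dyadic_val (k + 1) n = dyadic_val k n + 1 / 2 ^+ n.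
Proof. by rewrite /dyadic_val rmorphD mulrDl. Qed.

Lemma dyadic_game_reduced (k : int) (n : nat) : exists (l : int) (m : nat),
  [/\ dyadic_game k n = dyadic_game l m, dyadic_val k n = dyadic_val l m
    & (0 < m)%N -> ~~ (2 %| l)%Z].
Proof.
elim: n k => [|n IHn] k; first by exists k, 0%N.
have [even_k|odd_k] := boolP (2 %| k)%Z; last by exists k, n.+1.
have [l [m [eq_game eq_val red]]] := IHn (k %/ 2)%Z.
exists l, m; split=> //=; first by rewrite even_k.
by rewrite -eq_val -[RHS]dyadic_val_even [2 * _]mulrC divzK.
Qed.

Lemma dyadic_game_odd (k : int) (n : nat) : ~~ (2 %| k)%Z ->
  exists l : int, k = 2 * l + 1
    /\ dyadic_game k n.+1 = Game [:: dyadic_game l n] [:: dyadic_game (l + 1) n].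
Proof.
move=> odd_k; exists (k %/ 2)%Z; split; last by rewrite /= (negbTE odd_k).
lia.
Qed.

Lemma int_game_pos (n : nat) :
  int_game n.+1 = Game [:: int_game n] [::].
Proof. by []. Qed.

Lemma int_game_neg (n : nat) :
  int_game (- n.+1%:Z) = Game [::] [:: int_game (- n%:Z)].
Proof. by case: n. Qed.

(** The sharp move: in lowest terms, the Left option of k / 2^n loses exactly
1 / 2^n, and for integers (n = 0) such an option exists only when k > 0. *)
Lemma dyadic_game_option_left (k : int) (n : nat) :
    (0 < n)%N || (0 < k) -> ((0 < n)%N -> ~~ (2 %| k)%Z) ->
  exists (l : int) (m : nat),
    dyadic_game l m \in options Left (dyadic_game k n)
    /\ dyadic_val l m = dyadic_val k n - 1 / 2 ^+ n.
Proof.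
case: n => [|n] pos red.
  case: k pos {red} => // -[] // k _; exists k, 0%N.
  rewrite mem_head; split=> //.
  by rewrite -[k.+1]addn1 PoszD dyadic_val_succ addrK.
have [l [eq_k ->]] := dyadic_game_odd n (red isT); rewrite eq_k; exists l, n.
by rewrite mem_head dyadic_val_succ dyadic_val_even addrK.
Qed.

Lemma game_opp_dyadic (k : int) (n : nat) :
  game_opp (dyadic_game k n) = dyadic_game (- k) n.
Proof.
elim: n k => [|n IHn] k /=.
  case: k => [] k.
    elim: k => // k IHk; rewrite int_game_neg int_game_pos.
    by rewrite -IHk.
  rewrite NegzE opprK.
  elim: k => // k IHk; rewrite int_game_neg int_game_pos.
  by rewrite -IHk.
have -> : (2 %| - k)%Z = (2 %| k)%Z by lia.
case: ifP => even_k; first by rewrite IHn; congr dyadic_game; lia.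
by rewrite /= !IHn; congr (Game [:: _] [:: _]); congr dyadic_game; lia.
Qed.

Lemma dyadic_valN (k : int) (n : nat) : dyadic_val (- k) n = - dyadic_val k n.
Proof. by rewrite /dyadic_val rmorphN mulNr. Qed.

Lemma dyadic_game_option_right (k : int) (n : nat) :
    (0 < n)%N || (k < 0) -> ((0 < n)%N -> ~~ (2 %| k)%Z) ->
  exists (l : int) (m : nat),
    dyadic_game l m \in options Right (dyadic_game k n)
    /\ dyadic_val l m = dyadic_val k n + 1 / 2 ^+ n.
Proof.
case: n => [|n] pos red.
  case: k pos {red} => k // _; exists (- k%:Z), 0%N.
  rewrite NegzE /dyadic_game int_game_neg mem_head; split=> //.
  by rewrite -dyadic_val_succ; congr dyadic_val; lia.
have [l [eq_k ->]] := dyadic_game_odd n (red isT); rewrite eq_k; exists (l + 1), n.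
rewrite mem_head -dyadic_val_succ -dyadic_val_even; split=> //.
by congr dyadic_val; ring.
Qed.

Lemma dyadic_game_options (s : player) (k : int) (n : nat) (X : game) :
    X \in options s (dyadic_game k n) ->
  exists (l : int) (m : nat), X = dyadic_game l m
    /\ (if s is Left then dyadic_val l m < dyadic_val k n
        else dyadic_val k n < dyadic_val l m).
Proof.
have [l [m [-> -> red]]] := dyadic_game_reduced k n.
have pos j : 0 < 1 / 2 ^+ j :> rat by rewrite divr_gt0 ?exprn_gt0.
case: m red => [_|m red].
  case: l => [] [|l]; case: s => //=; rewrite inE => /eqP ->.
  - exists l, 0%N; split=> //.
    by rewrite -[l.+1]addn1 PoszD dyadic_val_succ ltrDl.
  - by exists 0, 0%N.
  - exists (Negz l), 0%N; split=> //.
    by rewrite /dyadic_val !divr1 ltr_int; lia.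
have [j [eq_l ->]] := dyadic_game_odd m (red isT); rewrite eq_l.
case: s; rewrite /= inE => /eqP ->; [exists j, m | exists (j + 1), m].
  by rewrite dyadic_val_succ dyadic_val_even ltrDl.
rewrite -[dyadic_val (j + 1) m]dyadic_val_even; split=> //.
by rewrite /dyadic_val ltr_pM2r ?invr_gt0 ?exprn_gt0 // ltr_int; lia.
Qed.

Lemma dyadic_val_common_denominator (N : nat) (k : int) (n : nat) : (n <= N)%N ->
  exists j : int, dyadic_val k n = j%:~R / 2 ^+ N.
Proof.
move=> leN; exists (k * 2 ^+ (N - n)).
rewrite /dyadic_val rmorphM rmorphXn /= -{2}(subnK leN) exprD.
have nz j : (2 : rat) ^+ j != 0 by rewrite expf_neq0.
by field; rewrite !nz.
Qed.

(** Every option of a dyadic game is worse for its mover, so a true inequality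
between values survives any move; this is one direction.  Conversely, if
x + y > z then the gap is at least 1 / 2^M, for M the largest of the three
exponents in lowest terms, and the component with exponent M offers a move that
costs exactly 1 / 2^M.  When M = 0, one of x > 0, y > 0 and z < 0 must hold,
which again provides the move.  The second equivalence is the first for the
negatives. *)
Lemma game_le_dyadic_sum (k1 k2 k3 : int) (n1 n2 n3 : nat) :
  game_le (game_add (dyadic_game k1 n1) (dyadic_game k2 n2)) (dyadic_game k3 n3)
    = (dyadic_val k1 n1 + dyadic_val k2 n2 <= dyadic_val k3 n3)
  /\ game_le (dyadic_game k3 n3)
       (game_add (dyadic_game k1 n1) (dyadic_game k2 n2))
    = (dyadic_val k3 n3 <= dyadic_val k1 n1 + dyadic_val k2 n2).
Proof.
have [N] := ubnP (game_size (dyadic_game k1 n1)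
                  + game_size (dyadic_game k2 n2)
                  + game_size (dyadic_game k3 n3)).
elim: N k1 k2 k3 n1 n2 n3 => // N IHN.
suff le_sum (k1 k2 k3 : int) (n1 n2 n3 : nat) :
    (game_size (dyadic_game k1 n1) + game_size (dyadic_game k2 n2)
       + game_size (dyadic_game k3 n3) < N.+1)%N ->
    game_le (game_add (dyadic_game k1 n1) (dyadic_game k2 n2))
        (dyadic_game k3 n3)
      = (dyadic_val k1 n1 + dyadic_val k2 n2 <= dyadic_val k3 n3).
  move=> k1 k2 k3 n1 n2 n3 ltN; split; first exact: le_sum.
  rewrite -game_le_opp game_opp_add !game_opp_dyadic le_sum.
    by rewrite !dyadic_valN -opprD lerN2.
  by rewrite -!game_opp_dyadic !game_size_opp.
have [l1 [m1 [-> -> red1]]] := dyadic_game_reduced k1 n1.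
have [l2 [m2 [-> -> red2]]] := dyadic_game_reduced k2 n2.
have [l3 [m3 [-> -> red3]]] := dyadic_game_reduced k3 n3.
move=> {k1 k2 k3 n1 n2 n3} ltN.
apply/idP/idP; last first.
  move=> le_val; apply/game_leP; split=> X.
    rewrite options_add mem_cat => /orP [] /mapP [Y inY ->];
      have ltY := game_size_option inY;
      have [k [n [eqY ltk]]] := dyadic_game_options inY;
      move: ltY; rewrite eqY => ltY.
      by rewrite (IHN _ _ _ _ _ _ _).2 -?ltNge; [lra | lia].
    by rewrite (IHN _ _ _ _ _ _ _).2 -?ltNge; [lra | lia].
  move=> inX; have ltX := game_size_option inX.
  have [k [n [eqX ltk]]] := dyadic_game_options inX.
  move: ltX; rewrite eqX => ltX.
  by rewrite (IHN _ _ _ _ _ _ _).2 -?ltNge; [lra | lia].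
apply: contraLR; rewrite -ltNge => lt_val.
(* All three values are multiples of 1 / 2 ^ M, hence the gap of 1 / 2 ^ M. *)
set M := maxn m1 (maxn m2 m3).
have gap : dyadic_val l3 m3 + 1 / 2 ^+ M <= dyadic_val l1 m1 + dyadic_val l2 m2.
  have [|j1 eq1] := @dyadic_val_common_denominator M l1 m1; first by lia.
  have [|j2 eq2] := @dyadic_val_common_denominator M l2 m2; first by lia.
  have [|j3 eq3] := @dyadic_val_common_denominator M l3 m3; first by lia.
  move: lt_val; rewrite eq1 eq2 eq3 -!mulrDl.
  rewrite ltr_pM2r ?ler_pM2r ?invr_gt0 ?exprn_gt0 //.
  by rewrite -[1]/(1%:~R) -!intrD ltr_int ler_int lezD1.
have [] : [\/ m1 = M /\ (0 < m1)%N || (0 < l1),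
              m2 = M /\ (0 < m2)%N || (0 < l2)
            | m3 = M /\ (0 < m3)%N || (l3 < 0)].
- have [M0|Mpos] := posnP M; last first.
    have [?|[?|?]] : m1 = M \/ m2 = M \/ m3 = M by lia.
    + by constructor 1; split=> //; apply/orP; left; lia.
    + by constructor 2; split=> //; apply/orP; left; lia.
    + by constructor 3; split=> //; apply/orP; left; lia.
  have [z1 [z2 z3]] : m1 = 0%N /\ m2 = 0%N /\ m3 = 0%N by lia.
  move: lt_val; rewrite M0 z1 z2 z3 /dyadic_val !divr1 -intrD ltr_int => lt_l.
  have [?|[?|?]] : 0 < l1 \/ 0 < l2 \/ l3 < 0 by lia.
  + by constructor 1.
  + by constructor 2.
  + by constructor 3.
- move=> [eqM /dyadic_game_option_left /(_ red1) [k [n [inX eqX]]]].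
  have ltX := game_size_option inX.
  apply/negP => /game_leP [leL _].
  have /leL/negP [] : game_add (dyadic_game k n) (dyadic_game l2 m2) \in
      options Left (game_add (dyadic_game l1 m1) (dyadic_game l2 m2)).
    by rewrite options_add mem_cat (map_f (game_add^~ _)).
  by rewrite (IHN _ _ _ _ _ _ _).2; [move: gap; rewrite eqX -eqM; lra | lia].
- move=> [eqM /dyadic_game_option_left /(_ red2) [k [n [inX eqX]]]].
  have ltX := game_size_option inX.
  apply/negP => /game_leP [leL _].
  have /leL/negP [] : game_add (dyadic_game l1 m1) (dyadic_game k n) \in
      options Left (game_add (dyadic_game l1 m1) (dyadic_game l2 m2)).
    by rewrite options_add mem_cat (map_f (game_add _)) ?orbT.
  by rewrite (IHN _ _ _ _ _ _ _).2; [move: gap; rewrite eqX -eqM; lra | lia].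
move=> [eqM /dyadic_game_option_right /(_ red3) [k [n [inX eqX]]]].
have ltX := game_size_option inX.
apply/negP => /game_leP [_ /(_ _ inX) /negP []].
by rewrite (IHN _ _ _ _ _ _ _).2; [move: gap; rewrite eqX -eqM; lra | lia].
Qed.

Lemma num_game_dyadic_val (k : int) (n : nat) :
  num_game (dyadic_val k n) = dyadic_game k n.
Proof.
have [l [m [-> -> red]]] := dyadic_game_reduced k n.
have pow2 : (2 ^+ m : rat) = (2 ^ m)%N%:Z%:~R by rewrite -natrX.
have cop : coprime `|l| `|(2 ^ m)%N%:Z|.
  rewrite absz_nat; case: m red {pow2} => [|m] red; first by rewrite coprimen1.
  rewrite coprime_sym coprimeXl // prime_coprime // .
  by move: (red isT); lia.
rewrite /num_game /dyadic_val pow2 coprimeq_num // coprimeq_den //.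
have -> : (2 ^ m)%N%:Z == 0 = false by have := expn_gt0 2 m; lia.
rewrite !absz_nat pfactorK //.
by rewrite gtr0_sg ?mul1r //; have := expn_gt0 2 m; lia.
Qed.

(** * Games equal to numbers *)

Lemma num_game0 : num_game 0 = game0.
Proof. by have := num_game_dyadic_val 0 0; rewrite /dyadic_val mul0r. Qed.

Lemma num_game_int (k : int) : num_game k%:~R = int_game k.
Proof. by have := num_game_dyadic_val k 0; rewrite /dyadic_val divr1. Qed.

Lemma game_opp_num (x : rat) :
  dyadic x -> game_opp (num_game x) = num_game (- x).
Proof.
move=> [k [n ->]]; rewrite -/(dyadic_val k n) -dyadic_valN.
by rewrite !num_game_dyadic_val game_opp_dyadic.
Qed.

Lemma num_game_options (s : player) (x : rat) (X : game) :
    dyadic x -> X \in options s (num_game x) ->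
  exists y : rat,
    [/\ dyadic y, X = num_game y & if s is Left then y < x else x < y].
Proof.
move=> [k [n ->]]; rewrite -/(dyadic_val k n) num_game_dyadic_val.
move=> /dyadic_game_options [l [m [-> ltlk]]].
by exists (dyadic_val l m); rewrite num_game_dyadic_val; split=> //; exists l, m.
Qed.

Lemma num_game_add (x y : rat) : dyadic x -> dyadic y ->
  game_eq (game_add (num_game x) (num_game y)) (num_game (x + y)).
Proof.
move=> dx dy; have [k3 [n3 eq3]] := dyadicD dx dy.
rewrite eq3; move: dx dy eq3 => [k1 [n1 ->]] [k2 [n2 ->]].
rewrite -!/(dyadic_val _ _) !num_game_dyadic_val => eq3.
have [le_sum ge_sum] := game_le_dyadic_sum k1 k2 k3 n1 n2 n3.
by rewrite /game_eq le_sum ge_sum eq3 lexx.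
Qed.

Lemma game_le_num (x y : rat) : dyadic x -> dyadic y ->
  game_le (num_game x) (num_game y) = (x <= y).
Proof.
move=> [k [n ->]] [l [m ->]]; rewrite -!/(dyadic_val _ _) !num_game_dyadic_val.
rewrite -[dyadic_game k n]game_add0 (game_le_dyadic_sum k 0 l n 0 m).1.
by rewrite {2}/dyadic_val mul0r addr0.
Qed.

Lemma equals_num_game (x : rat) : dyadic x -> equals_num (num_game x) x.
Proof. by split=> //; apply: game_eq_refl. Qed.

Lemma game_le_equals_num (G H : game) (x y : rat) :
  equals_num G x -> equals_num H y -> game_le G H = (x <= y).
Proof.
move=> [dx /andP [leGx lexG]] [dy /andP [leHy leyH]].
rewrite -game_le_num //; apply/idP/idP => le.
  exact: game_le_trans lexG (game_le_trans le leHy).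
exact: game_le_trans leGx (game_le_trans le leyH).
Qed.

Lemma equals_num_inj (G : game) (x y : rat) :
  equals_num G x -> equals_num G y -> x = y.
Proof.
move=> eGx eGy; apply: le_anti.
by rewrite -(game_le_equals_num eGx eGy) -(game_le_equals_num eGy eGx)
  game_le_refl.
Qed.

Lemma equals_numD (G H : game) (x y : rat) :
  equals_num G x -> equals_num H y -> equals_num (game_add G H) (x + y).
Proof.
move=> [dx /andP [leGx lexG]] [dy /andP [leHy leyH]].
split; first exact: dyadicD.
apply: game_eq_trans (num_game_add dx dy).
by rewrite /game_eq !game_le_add.
Qed.

Lemma equals_num_sub (G : game) (x q : rat) :
  equals_num G x -> dyadic q -> equals_num (game_sub G (num_game q)) (x - q).
Proof.
move=> eGx dq; rewrite /game_sub game_opp_num //.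
by apply: equals_numD eGx _; apply/equals_num_game/dyadicN.
Qed.

Lemma num_value_equals (G : game) (x : rat) :
  equals_num G x -> num_value G = x.
Proof.
by move=> eGx; apply: xget_unique => // y eGy; apply: equals_num_inj eGy eGx.
Qed.

Lemma stop_equals_num (s : player) (G : game) (x : rat) :
  equals_num G x -> stop s G = x.
Proof.
move=> eGx; have numG : is_num G by exists x.
have := num_value_equals eGx; case: G {eGx} numG => GL GR numG <- /=.
by rewrite asboolT.
Qed.

(** * Stops of a switch plus a number *)

Lemma stop_left_options (G : game) : ~ is_num G ->
  stop Left G = seq_max [seq stop Right X | X <- options Left G].
Proof. by case: G => GL GR notnum /=; rewrite asboolF. Qed.

Lemma stop_right_options (G : game) : ~ is_num G ->
  stop Right G = seq_min [seq stop Left Y | Y <- options Right G].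
Proof. by case: G => GL GR notnum /=; rewrite asboolF. Qed.

Lemma seq_max1 (x : rat) : seq_max [:: x] = x.
Proof. exact: maxxx. Qed.

Lemma seq_min1 (x : rat) : seq_min [:: x] = x.
Proof. exact: minxx. Qed.

Lemma seq_max_ge_head (x : rat) (r : seq rat) : x <= seq_max (x :: r).
Proof. by rewrite /seq_max /= le_max lexx. Qed.

Lemma seq_min_head (x : rat) (r : seq rat) :
  (forall y, y \in r -> x <= y) -> seq_min (x :: r) = x.
Proof.
rewrite /seq_min /= => le_r; apply/min_idPl.
elim: r le_r => //= y r IHr le_r; rewrite le_min le_r ?mem_head //=.
by apply: IHr => z inz; rewrite le_r // inE inz orbT.
Qed.

(** A number x equal to G would have to satisfy x < c <= b, and hence x <= X for
the Left option X of G; but no Left option of G is at least G.  The Left option is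
bounded below only by the numbers under b, because it is itself a switch in the
application to [freezing_threat]. *)
Lemma hot_not_num (G X Y : game) (b c : rat) :
    X \in options Left G -> Y \in options Right G ->
    (forall x, dyadic x -> x < b -> game_le (num_game x) X) ->
    equals_num Y c -> c <= b -> ~ is_num G.
Proof.
move=> inX inY leX eYc le_cb [x [dx /andP [leGx lexG]]].
have ltxc : x < c.
  rewrite ltNge -(game_le_equals_num eYc (equals_num_game dx)).
  apply/negP => leYx; case/negP: (option_right_nle inY).
  exact: game_le_trans leYx lexG.
case/negP: (option_left_nge inX); apply: game_le_trans leGx (leX _ dx _).
exact: lt_le_trans le_cb.
Qed.

Section TranslatedSwitch.

Variables (A B : game) (a b : rat).
Hypotheses (eAa : equals_num A a) (eBb : equals_num B b) (le_ba : b <= a).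

Let S := Game [:: A] [:: B].

Let options_left (W : game) :
  options Left (game_add S W)
    = game_add A W :: [seq game_add S X | X <- options Left W].
Proof. by rewrite options_add. Qed.

Let options_right (W : game) :
  options Right (game_add S W)
    = game_add B W :: [seq game_add S Y | Y <- options Right W].
Proof. by rewrite options_add. Qed.

Let eAW (w : rat) : dyadic w -> equals_num (game_add A (num_game w)) (a + w).
Proof. by move=> dw; apply: equals_numD => //; apply: equals_num_game. Qed.

Let eBW (w : rat) : dyadic w -> equals_num (game_add B (num_game w)) (b + w).
Proof. by move=> dw; apply: equals_numD => //; apply: equals_num_game. Qed.

Lemma switch_num_not_num (w : rat) :
  dyadic w -> ~ is_num (game_add S (num_game w)).
Proof.
move=> dw; apply: (@hot_not_num _ (game_add A (num_game w))
                     (game_add B (num_game w)) (a + w) (b + w)).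
- by rewrite options_left mem_head.
- by rewrite options_right mem_head.
- move=> x dx ltx.
  by rewrite (game_le_equals_num (equals_num_game dx) (eAW dw)) ltW.
- exact: eBW.
- by rewrite lerD2r.
Qed.

(** Right cannot profit from moving in w: Left then answers in the switch, to
a + v > b + w > x. *)
Lemma game_le_switch_num (w x : rat) : dyadic w -> dyadic x -> x < b + w ->
  game_le (num_game x) (game_add S (num_game w)).
Proof.
move=> dw dx ltx; apply/game_leP; split=> X.
  move=> /(num_game_options dx) [y [dy -> lt_yx]]; apply/negP => le_sum.
  have inA : game_add A (num_game w)
      \in options Left (game_add S (num_game w)).
    by rewrite options_left mem_head.
  case/negP: (option_left_nge inA); apply: game_le_trans le_sum _.
  rewrite (game_le_equals_num (equals_num_game dy) (eAW dw)).
  by move: le_ba; lra.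
rewrite options_right inE => /orP [/eqP -> | /mapP [Y inY ->]].
  by rewrite (game_le_equals_num (eBW dw) (equals_num_game dx)) -ltNge.
have [v [dv -> lt_wv]] := num_game_options dw inY.
have inA : game_add A (num_game v) \in options Left (game_add S (num_game v)).
  by rewrite options_left mem_head.
apply/negP => le_x; case/negP: (option_left_nge inA).
apply: game_le_trans le_x _.
rewrite (game_le_equals_num (equals_num_game dx) (eAW dv)).
by move: le_ba; lra.
Qed.

Lemma stop_left_switch_num_ge (w : rat) : dyadic w ->
  a + w <= stop Left (game_add S (num_game w)).
Proof.
move=> dw; rewrite stop_left_options; last exact: switch_num_not_num.
rewrite options_left map_cons -(stop_equals_num Right (eAW dw)).
exact: seq_max_ge_head.
Qed.

(** Right's move in the switch achieves b + w.  After a move of Right in w, to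
some v > w, Left can still reach a + v >= b + w, so this is not better. *)
Lemma stop_right_switch_num (w : rat) : dyadic w ->
  stop Right (game_add S (num_game w)) = b + w.
Proof.
move=> dw; rewrite stop_right_options; last exact: switch_num_not_num.
rewrite options_right map_cons (stop_equals_num Left (eBW dw)).
apply: seq_min_head => y /mapP [X /mapP [Y inY ->] ->].
have [v [dv -> lt_wv]] := num_game_options dw inY.
by apply: le_trans (stop_left_switch_num_ge dv); move: le_ba; lra.
Qed.

Lemma switch_not_num : ~ is_num S.
Proof. by rewrite -[S]game_add0 -num_game0; apply/switch_num_not_num/dyadic0. Qed.

Lemma stop_left_switch : stop Left S = a.
Proof.
by rewrite (stop_left_options switch_not_num) seq_max1 (stop_equals_num _ eAa).
Qed.

Lemma stop_right_switch : stop Right S = b.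
Proof.
by rewrite (stop_right_options switch_not_num) seq_min1 (stop_equals_num _ eBb).
Qed.

End TranslatedSwitch.

(** * Penalized games *)

(** The raw game of which [penalized] is the truncation at the freezing point. *)
Definition cooled (G : game) (p : rat) : game :=
  let: Game GL GR := G in
  Game [seq game_sub (penalized X p) (num_game p) | X <- GL]
       [seq game_add (penalized Y p) (num_game p) | Y <- GR].

Definition freezing (G : game) (t : rat) : Prop :=
  least_dyadic (fun p => stop Left (cooled G p) = stop Right (cooled G p)) t.

Lemma freezing_unique (G : game) (t u : rat) :
  freezing G t -> freezing G u -> t = u.
Proof.
move=> [dt t0 eqt mint] [du u0 equ minu].
by apply: le_anti; rewrite mint ?minu.
Qed.

(** The choice operator in [penalized] picks the freezing point, because a least
element is unique. *)
Lemma penalized_freezing (G : game) (t p : rat) : freezing G t ->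
  penalized G p = if p <= t then cooled G p
                  else num_game (stop Left (cooled G t)).
Proof.
move=> frt; have <- : xget 0 [set q | freezing G q]%classic = t.
  by apply: xget_unique => // u fru; apply: freezing_unique fru frt.
by case: G {frt}.
Qed.

Lemma freezing_least_penalized (G : game) (t : rat) : freezing G t ->
  least_dyadic (fun p => stop Left (penalized G p) = stop Right (penalized G p))
    t.
Proof.
move=> frt; have [dt t0 eqt mint] := frt; split=> //.
  by rewrite (penalized_freezing _ frt) lexx.
move=> q dq q0; rewrite (penalized_freezing _ frt).
by case: (leP q t) => [le_qt /mint | /ltW //]; apply.
Qed.

(** A number freezes at 0: its options being unaffected by the penalty 0, it is
its own cooled game there, and its two stops agree. *)
Lemma penalized_num (x p : rat) : dyadic x -> 0 <= p ->
  penalized (num_game x) p = num_game x.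
Proof.
suff ind G : forall y q, num_game y = G -> dyadic y -> 0 <= q ->
    penalized (num_game y) q = num_game y by exact: ind.
elim/game_ind_options: G {x p} => G IH x p eqG dx p0.
have opt s X : X \in options s G -> penalized X 0 = X.
  move=> inX; have := inX; rewrite -eqG => /(num_game_options dx) [y [dy eqX _]].
  by rewrite eqX; apply: (IH s X inX).
have cooled0 : cooled (num_game x) 0 = num_game x.
  rewrite eqG; case: G opt {IH eqG} => GL GR opt /=; rewrite num_game0.
  congr Game; rewrite -[RHS]map_id; apply/eq_in_map => X inX.
    by rewrite (opt Left) // /game_sub game_add0.
  by rewrite (opt Right) // game_add0.
have stopx s : stop s (num_game x) = x.
  by apply: stop_equals_num; apply: equals_num_game.
have fr0 : freezing (num_game x) 0.
  by split; rewrite ?cooled0 ?stopx //; apply: dyadic0.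
rewrite (penalized_freezing _ fr0) cooled0 stopx.
by case: ifP => // le_p0; have -> : p = 0 by apply: le_anti; rewrite le_p0.
Qed.

Lemma cooled_switch (a b p : rat) : dyadic a -> dyadic b -> 0 <= p ->
  cooled (Game [:: num_game a] [:: num_game b]) p
    = Game [:: game_sub (num_game a) (num_game p)]
           [:: game_add (num_game b) (num_game p)].
Proof. by move=> da db p0; rewrite /= !penalized_num. Qed.

(** * Temperatures of switches and of one-sided threats *)

Lemma freezing_switch (a b : rat) : dyadic a -> dyadic b -> b <= a ->
  freezing (Game [:: num_game a] [:: num_game b]) ((a - b) / 2).
Proof.
move=> da db le_ba.
have dt : dyadic ((a - b) / 2) by apply/dyadic_half/dyadicD/dyadicN.
have stops p : dyadic p -> 0 <= p -> p <= (a - b) / 2 ->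
  (stop Left (cooled (Game [:: num_game a] [:: num_game b]) p) = a - p)
  /\ (stop Right (cooled (Game [:: num_game a] [:: num_game b]) p) = b + p).
  move=> dp p0 le_pt; rewrite cooled_switch //.
  have ea := equals_num_sub (equals_num_game da) dp.
  have eb := equals_numD (equals_num_game db) (equals_num_game dp).
  have le_ba' : b + p <= a - p by lra.
  by rewrite (stop_left_switch ea eb) ?(stop_right_switch ea eb).
split=> //; first by lra.
  by have [|-> ->] := stops _ dt _ (lexx _); lra.
move=> q dq q0; apply: contra_eqT; rewrite -ltNge => lt_qt.
have [-> ->] := stops q dq q0 (ltW lt_qt).
by apply/eqP; lra.
Qed.

(** The game {{a | b} | c}: below the temperature of the switch {a | b}, the tax
that Left pays for creating the switch is refunded by Right's answer to b.  Hence
the Left stop is constantly b until it meets the Right stop c + p, at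
p = b - c. *)
Section Threat.

Variables (a b c : rat).
Hypotheses (da : dyadic a) (db : dyadic b) (dc : dyadic c).
Hypotheses (le_cb : c <= b) (le_t : b - c <= (a - b) / 2).

Let S := Game [:: num_game a] [:: num_game b].
Let K := Game [:: S] [:: num_game c].

Lemma threat_not_num : ~ is_num K.
Proof.
apply: (@hot_not_num _ S (num_game c) b c); rewrite ?mem_head //.
  move=> x dx ltx; rewrite -[S]game_add0 -num_game0.
  apply: (@game_le_switch_num _ _ a b) => //; rewrite ?addr0 //;
    try exact: equals_num_game.
  - by move: le_cb le_t; lra.
  - exact: dyadic0.
exact: equals_num_game.
Qed.

Lemma freezing_threat : freezing K (b - c).
Proof.
have dt : dyadic (b - c) by apply/dyadicD/dyadicN.
have stops p : dyadic p -> 0 <= p -> p <= b - c ->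
    stop Left (cooled K p) = b /\ stop Right (cooled K p) = c + p.
  move=> dp p0 le_pt.
  have ea := equals_num_sub (equals_num_game da) dp.
  have eb := equals_numD (equals_num_game db) (equals_num_game dp).
  have ec := equals_numD (equals_num_game dc) (equals_num_game dp).
  have dNp := dyadicN dp.
  have le_ba : b + p <= a - p by move: le_cb le_t; lra.
  have eqK : cooled K p =
      Game [:: game_add (Game [:: game_sub (num_game a) (num_game p)]
                              [:: game_add (num_game b) (num_game p)])
                        (num_game (- p))]
           [:: game_add (num_game c) (num_game p)].
    rewrite -game_opp_num // -cooled_switch // -/S.
    rewrite /cooled /K /map penalized_num // (@penalized_freezing S ((a - b) / 2)).
      by rewrite ifT // (le_trans le_pt).
    by apply: freezing_switch => //; move: le_cb le_t; lra.
  have notnum : ~ is_num (cooled K p).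
    rewrite eqK; set SW := game_add (Game _ _) _.
    apply: (@hot_not_num _ SW (game_add (num_game c) (num_game p)) b (c + p));
      rewrite ?mem_head //.
      by move=> x dx ltx; apply: (game_le_switch_num ea eb) => //; rewrite addrK.
    by lra.
  rewrite stop_left_options // stop_right_options // eqK.
  rewrite seq_max1 seq_min1 (stop_right_switch_num ea eb) //.
  by rewrite (stop_equals_num _ ec) addrK.
split=> //; first by rewrite subr_ge0.
  have [||-> ->] := stops _ dt; rewrite ?subr_ge0 //.
  by rewrite addrC subrK.
move=> q dq q0; apply: contra_eqT; rewrite -ltNge => lt_qt.
have [-> ->] := stops q dq q0 (ltW lt_qt).
by apply/eqP; lra.
Qed.

End Threat.

(** * The two Robin Hood heaps *)

Lemma temperature_canonical (G K : game) (t : rat) :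
  Defs.canonical K -> game_eq K G -> ~ is_num K -> freezing K t -> temperature G t.
Proof.
move=> canK eqKG notnum frt; right; split.
  by move=> [x [dx eqGx]]; apply: notnum; exists x; split=> //;
    apply: game_eq_trans eqGx.
by exists K; split=> //; apply: freezing_least_penalized.
Qed.

Definition hot_switch : game := Game [:: int_game 2] [:: int_game (- 2)].

Lemma hot_switchE : hot_switch = Game [:: num_game 2] [:: num_game (- 2)].
Proof. by rewrite (num_game_int 2) (num_game_int (- 2)). Qed.

Lemma temperature_311 : temperature (rh_game (RobinHood 3 1 1)) 2.
Proof.
have d2 : dyadic 2 := dyadic_int 2.
have le22 : - 2 <= 2 :> rat by lra.
have eq_t : (2 - (- 2)) / 2 = 2 :> rat by lra.
apply: (@temperature_canonical _ hot_switch); [by vm_compute | by vm_compute | |];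
  rewrite hot_switchE.
  exact: switch_not_num (equals_num_game d2) (equals_num_game (dyadicN d2)) le22.
rewrite -[X in freezing _ X]eq_t.
exact: freezing_switch d2 (dyadicN d2) le22.
Qed.

Lemma temperature_412 : temperature (rh_game (RobinHood 4 1 2)) 1.
Proof.
have d2 : dyadic 2 := dyadic_int 2.
have dN3 : dyadic (- 3) := dyadic_int (- 3).
have le32 : - 3 <= - 2 :> rat by lra.
have le_t : - 2 - (- 3) <= (2 - (- 2)) / 2 :> rat by lra.
have eq_t : - 2 - (- 3) = 1 :> rat by lra.
apply: (@temperature_canonical _ (Game [:: hot_switch] [:: int_game (- 3)]));
  [by vm_compute | by vm_compute | |];
  rewrite hot_switchE -(num_game_int (- 3)).
  exact: threat_not_num d2 (dyadicN d2) dN3 le32 le_t.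
rewrite -[X in freezing _ X]eq_t.
exact: freezing_threat d2 (dyadicN d2) dN3 le32 le_t.
Qed.

Theorem theorem1p2 :
  exists (S : seq robin_hood) (t : seq rat) (s : player) (m : nat * nat),
    [/\ (2 <= size S)%N,
        size t = size S
          /\ (forall c : nat, (c < size S)%N ->
                temperature (rh_game (component S c)) (nth 0 t c)),
        uniq t,
        winning_move s S m
          /\ (forall m' : nat * nat, winning_move s S m' -> m' = m)
      & forall c : nat, (c < size S)%N -> nth 0 t m.1 <= nth 0 t c].
Proof.
exists [:: RobinHood 4 1 2; RobinHood 3 1 1], [:: 1; 2], Left, (0%N, 1%N).
split=> //.
- split=> // -[|[|//]] _; [exact: temperature_412 | exact: temperature_311].
- split; first by vm_compute.
  move=> [c i] /andP [/andP [/= lt_c legal_i] win].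
  have eq_i : i = 1%N.
    by move: lt_c legal_i; case: c {win} => [|[|//]] _; case: i => [|[|]].
  (* Right refutes the other move, (1, 1), by moving to -3 + 2. *)
  by move: win; rewrite eq_i; case: c lt_c {legal_i} => [|[|//]] _.
- by case=> [|[|]].
Qed.
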